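(* Let $H$ be a Hadamard space. Then the Chebyshev selection map $\mathrm{cheb}:K(H)\to H$, $V\mapsto\mathrm{cheb}(V)$, is generalised Hölder with power constant $1/2$: for every subset $\mathcal B\subset K(H)$ that is bounded with respect to the Hausdorff distance $\mathrm{Hd}$ there exists a constant $C>0$ such that for all $V,W\in\mathcal B$ $$d(\mathrm{cheb}(V),\mathrm{cheb}(W))\le C\,\mathrm{Hd}(V,W)^{1/2}.$$
   Context: A Hadamard space is a complete CAT(0) metric space $(H,d)$. $K(H)$ is the set of all nonempty compact (geodesically) convex subsets of $H$, equipped with the Hausdorff distance $\mathrm{Hd}$. For $V\in K(H)$, $\mathrm{cheb}(V)$ denotes the Chebyshev center of $V$, i.e. the (in this setting unique) point $c\in H$ minimizing $c\mapsto\sup_{v\in V}d(c,v)$. ''Generalised Hölder'' means Hölder with a constant that is allowed to depend on the size of the sets considered. *)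

(* Defs.v *)
From HB Require Import structures.
From mathcomp Require Import all_boot all_order all_algebra.
From mathcomp Require Import all_classical all_reals all_analysis.

Set Implicit Arguments.
Unset Strict Implicit.
Unset Printing Implicit Defensive.

Import Order.TTheory GRing.Theory Num.Theory.

Local Open Scope classical_set_scope.
Local Open Scope ring_scope.

(* As in the library, complete spaces are pointed, hence nonempty. *)
#[short(type="completeMetricType")]
HB.structure Definition CompleteMetric (R : numDomainType) :=
  { M of Complete M & Metric R M }.

(* The Euclidean distance on the plane: the library norm on [R * R] is the
   max norm. *)
Definition edist2 (R : realType) (a b : R * R) : R :=
  Num.sqrt ((a.1 - b.1) ^+ 2 + (a.2 - b.2) ^+ 2).

Definition segment2 (R : realType) (a b : R * R) : set (R * R) :=
  [set (1 - s) *: a + s *: b | s in `[0, 1]].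

Section Geodesics.
Context (R : realType) (H : metricType R).
Implicit Types (x y p q r : H) (g : R -> H) (V W : set H).

(* Geodesics are parametrized by arc length; [g] is only relevant on
   [[0, mdist x y]]. *)
Definition geodesic x y g : Prop :=
  [/\ g 0 = x, g (mdist x y) = y &
      {in `[0, mdist x y] &, forall s t, mdist (g s) (g t) = `|s - t|}].

Definition geodesic_space : Prop := forall x y, exists g, geodesic x y g.

(* [a] is a comparison point, on the side [[p', q']] of a comparison triangle,
   for the point [x] of the side [g] from [p] to [q]. *)
Definition comparison_point p q g (p' q' : R * R) x (a : R * R) : Prop :=
  [/\ (g @` `[0, mdist p q]) x, segment2 p' q' a & edist2 p' a = mdist p x].

(* The CAT(0) inequality for all pairs of points of all geodesic triangles,
   with sides [g1] from [p] to [q], [g2] from [q] to [r], [g3] from [r] to [p]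
   and comparison triangle [p'], [q'], [r'] in the Euclidean plane. *)
Definition cat0 : Prop :=
  geodesic_space /\
  forall p q r g1 g2 g3 (p' q' r' : R * R),
    geodesic p q g1 -> geodesic q r g2 -> geodesic r p g3 ->
    edist2 p' q' = mdist p q ->
    edist2 q' r' = mdist q r ->
    edist2 r' p' = mdist r p ->
    let compare x a := [\/ comparison_point p q g1 p' q' x a,
                           comparison_point q r g2 q' r' x a |
                           comparison_point r p g3 r' p' x a] in
    forall x y a b, compare x a -> compare y b -> mdist x y <= edist2 a b.

Definition geodesically_convex V : Prop :=
  forall x y g, V x -> V y -> geodesic x y g -> g @` `[0, mdist x y] `<=` V.

Definition hausdorff_dist V W : R :=
  Num.max (sup [set inf [set mdist v w | w in W] | v in V])
          (sup [set inf [set mdist v w | v in V] | w in W]).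

Definition radius_at V (c : H) : R := sup [set mdist c v | v in V].

(* The members of K(H). For these, all suprema and infima above are taken over
   nonempty bounded sets, so the conventions for [sup] and [inf] outside this
   case are irrelevant. *)
Definition compact_convex_sets : set (set H) :=
  [set V | [/\ V !=set0, compact V & geodesically_convex V]].

Definition hausdorff_bounded (B : set (set H)) : Prop :=
  exists M : R, forall V W, B V -> B W -> hausdorff_dist V W <= M.

Definition chebyshev_center V (c : H) : Prop :=
  forall c', radius_at V c <= radius_at V c'.

End Geodesics.

Arguments compact_convex_sets {R} H _.

(* Members of K(H) in a Hadamard space have exactly one Chebyshev center, which
   is then the value chosen by [get]. *)
Definition cheb (R : realType) (H : completeMetricType R) (V : set H) : H :=
  get [set c | chebyshev_center V c].

(* Main.v *)
Require Import Defs.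
From HB Require Import structures.
From mathcomp Require Import all_boot all_order all_algebra.
From mathcomp Require Import all_classical all_reals all_analysis.
From mathcomp Require Import lra ring.

Set Implicit Arguments.
Unset Strict Implicit.
Unset Printing Implicit Defensive.

Local Open Scope classical_set_scope.
Local Open Scope ring_scope.

Import Order.TTheory GRing.Theory Num.Theory.
Import metricType_numDomainType.

(** Write [f_V c] for the radius [radius_at V c] of the smallest closed ball
    around [c] that contains [V]. In a CAT(0) space any two points [x], [y] have
    a midpoint [m] with
      d(z, m)^2 <= (d(z, x)^2 + d(z, y)^2) / 2 - d(x, y)^2 / 4   for all z
    (the Bruhat-Tits inequality, [cat0_midpoint]), and taking the supremum over
    [z] in [V] turns it into uniform convexity of [f_V^2]
    ([radius_midpoint]):
      d(x, y)^2 / 4 <= (f_V(x)^2 + f_V(y)^2) / 2 - f_V(m)^2.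
    So two points at which [f_V] is nearly minimal are close to each other,
    which is used twice. It makes the sublevel sets of [f_V] just above the
    infimum a Cauchy filter, whose limit is a Chebyshev center
    ([chebyshev_center_exists]). And it compares the centers [c] of [V] and
    [c'] of [W] ([chebyshev_center_stable]): with [h = Hd(V, W)], the functions
    [f_V] and [f_W] differ by at most [h] ([radius_le_hausdorff]), so
      f_V(c') <= f_W(c') + h <= f_W(c) + h <= f_V(c) + 2 h,
    whence d(c, c')^2 <= 8 h (f_V(c) + h). On a Hausdorff-bounded family both
    [f_V(c)] and [h] are bounded, and taking square roots gives the
    exponent 1/2. *)

(** * Radius of a compact set about a point *)

(** Near a point [x], distances to [c] stay below [mdist c x + 1]; by compactness
    finitely many such local bounds suffice, that is, a single large [M]. *)
Lemma compact_mdist_ubound (R : realType) (H : metricType R) (V : set H)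
    (c : H) :
  compact V -> has_ubound [set mdist c v | v in V].
Proof.
rewrite compact_near_coveringP => /(_ R +oo (fun M x => mdist c x <= M)).
case=> [|M [Mr MV]]; last first.
  exists (M + 1) => _ [v Vv <-].
  by apply: MV => //; rewrite ltrDl.
move=> x _; near=> y M => /=.
apply: (@le_trans _ _ (mdist c x + 1)); last first.
  by near: M; apply: nbhs_pinfty_ge; rewrite num_real.
apply: (le_trans (metric_triangle _ x _)); rewrite lerD2l ltW//.
near: y; exact: (@cvgr_dist_lt _ _ _ (nbhs x) _ id x).
Unshelve. all: by end_near. Qed.

Lemma mdist_le_radius (R : realType) (H : metricType R) (V : set H) (c v : H) :
  compact V -> V v -> mdist c v <= radius_at V c.
Proof.
move=> cV Vv; apply: ub_le_sup; first exact: compact_mdist_ubound.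
by exists v.
Qed.

Lemma radius_le (R : realType) (H : metricType R) (V : set H) (c : H) (r : R) :
  V !=set0 -> (forall v, V v -> mdist c v <= r) -> radius_at V c <= r.
Proof.
move=> [v0 Vv0] Vr; apply: ge_sup; first by exists (mdist c v0), v0.
by move=> _ [v Vv <-]; exact: Vr.
Qed.

Lemma radius_ge0 (R : realType) (H : metricType R) (V : set H) (c : H) :
  V !=set0 -> compact V -> 0 <= radius_at V c.
Proof.
move=> [v Vv] cV; apply: le_trans (mdist_ge0 c v) _; exact: mdist_le_radius.
Qed.

Lemma radius_lipschitz (R : realType) (H : metricType R) (V : set H) (x y : H) :
  V !=set0 -> compact V -> radius_at V x <= radius_at V y + mdist x y.
Proof.
move=> V0 cV; apply: radius_le => // v Vv.
rewrite addrC (le_trans (metric_triangle _ y _))// lerD2l.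
exact: mdist_le_radius.
Qed.

(** * Hausdorff distance *)

Lemma excess_adherent (R : realType) (H : metricType R) (V W : set H) (v : H)
    (e : R) :
  compact V -> W !=set0 -> V v -> 0 < e ->
  exists2 w, W w &
    mdist v w < sup [set inf [set mdist v w | w in W] | v in V] + e.
Proof.
move=> cV [w0 Ww0] Vv e0.
have lb u : has_lbound [set mdist u w | w in W].
  by exists 0 => _ [w _ <-]; exact: mdist_ge0.
have [||_ [w Ww <-] hw] := @inf_adherent R [set mdist v w | w in W] e => //.
  by split=> //; exists (mdist v w0), w0.
exists w => //; apply: (lt_le_trans hw); rewrite lerD2r.
apply: ub_le_sup; last by exists v.
have [M VM] := compact_mdist_ubound w0 cV.
exists M => _ [u Vu <-]; apply: (@le_trans _ _ (mdist u w0)).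
  by apply: ge_inf => //; exists w0.
by rewrite metric_sym; apply: VM; exists u.
Qed.

Lemma hausdorff_distC (R : realType) (H : metricType R) (V W : set H) :
  hausdorff_dist V W = hausdorff_dist W V.
Proof.
rewrite /hausdorff_dist maxC; congr (Num.max (sup _) (sup _)).
all: apply: eq_imagel => u _; congr inf.
all: by apply: eq_imagel => u' _; exact: metric_sym.
Qed.

Lemma hausdorff_dist_adherent (R : realType) (H : metricType R) (V W : set H)
    (v : H) (e : R) :
  compact V -> W !=set0 -> V v -> 0 < e ->
  exists2 w, W w & mdist v w < hausdorff_dist V W + e.
Proof.
move=> cV W0 Vv e0; have [w Ww vw] := excess_adherent cV W0 Vv e0.
by exists w => //; rewrite (lt_le_trans vw)// lerD2r le_max lexx.
Qed.

Lemma hausdorff_dist_ge0 (R : realType) (H : metricType R) (V W : set H) :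
  compact V -> V !=set0 -> W !=set0 -> 0 <= hausdorff_dist V W.
Proof.
move=> cV [v Vv] W0; apply/ler_addgt0Pr => e e0.
have [w _ /ltW] := hausdorff_dist_adherent cV W0 Vv e0.
exact/le_trans/mdist_ge0.
Qed.

(** Every point of [V] is within [Hd(V, W) + e] of some point of [W]. *)
Lemma radius_le_hausdorff (R : realType) (H : metricType R) (V W : set H)
    (c : H) :
  compact V -> V !=set0 -> compact W -> W !=set0 ->
  radius_at V c <= radius_at W c + hausdorff_dist V W.
Proof.
move=> cV V0 cW W0; apply: radius_le => // v Vv; apply/ler_addgt0Pr => e e0.
have [w Ww vw] := hausdorff_dist_adherent cV W0 Vv e0.
rewrite (le_trans (metric_triangle _ w _))// -addrA lerD ?mdist_le_radius//.
by rewrite metric_sym ltW.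
Qed.

(** * The Bruhat-Tits inequality *)

Lemma edist2_sqr (R : realType) (a b : R * R) :
  edist2 a b ^+ 2 = (a.1 - b.1) ^+ 2 + (a.2 - b.2) ^+ 2.
Proof. by rewrite sqr_sqrtr// addr_ge0 ?sqr_ge0. Qed.

(** The law of cosines dictates the first coordinate [u] of the apex over the
    base from [(0, 0)] to [(a, 0)]; the triangle inequalities are what makes
    [c^2 - u^2], the square of the height, nonnegative. *)
Lemma comparison_apex_exists (R : realType) (a b c : R) :
  0 < a -> 0 <= b -> 0 <= c -> a <= b + c -> b <= a + c -> c <= a + b ->
  exists r : R * R, edist2 (a, 0) r = b /\ edist2 r (0, 0) = c.
Proof.
move=> a0 b0 c0 abc bac cab.
have [u ua] : exists u, 2 * a * u = a ^+ 2 + c ^+ 2 - b ^+ 2.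
  exists ((a ^+ 2 + c ^+ 2 - b ^+ 2) / (2 * a)).
  by rewrite mulrC divfK// mulf_neq0 ?gt_eqF.
have uc : 0 <= c ^+ 2 - u ^+ 2.
  rewrite subr_sqr mulr_ge0 // -(@pmulr_rge0 _ (2 * a)) ?mulr_gt0//.
    have -> : 2 * a * (c - u) = (b - (a - c)) * (b + (a - c)).
      by rewrite mulrBr ua; ring.
    by rewrite mulr_ge0//; lra.
  have -> : 2 * a * (c + u) = (a + c - b) * (a + c + b).
    by rewrite mulrDr ua; ring.
  by rewrite mulr_ge0//; lra.
exists (u, Num.sqrt (c ^+ 2 - u ^+ 2)); rewrite /edist2 /=; split.
  rewrite sub0r sqrrN sqr_sqrtr//.
  rewrite (_ : _ + _ = b ^+ 2) ?sqrtr_sqr ?ger0_norm//.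
  have -> : b ^+ 2 = a ^+ 2 + c ^+ 2 - 2 * a * u by rewrite ua; ring.
  by ring.
by rewrite !subr0 sqr_sqrtr// addrC subrK sqrtr_sqr ger0_norm.
Qed.

(** The CAT(0) inequality compares the distance from [z] to the midpoint of the
    side [[x, y]] with the length of a median of the Euclidean comparison
    triangle, which the parallelogram law computes. *)
Lemma cat0_midpoint (R : realType) (H : metricType R) (x y : H) : cat0 H ->
  exists m, forall z, mdist z m ^+ 2 <=
    (mdist z x ^+ 2 + mdist z y ^+ 2) / 2 - mdist x y ^+ 2 / 4.
Proof.
move=> [geo cmp]; have [<-|xy] := eqVneq x y.
  by exists x => z; rewrite mdistxx; lra.
have a0 : 0 < mdist x y by rewrite mdist_gt0.
have [g1 [g1x g1y g1i]] := geo x y.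
set a := mdist x y in a0 g1y g1i *.
exists (g1 (a / 2)) => z.
have [g2 [g2y g2z g2i]] := geo y z; have [g3 g3P] := geo z x.
have [||||| r [br cr]] :=
    @comparison_apex_exists R a (mdist y z) (mdist z x) a0.
- exact: mdist_ge0.
- exact: mdist_ge0.
- by rewrite /a addrC (metric_sym z) (metric_sym y) metric_triangle.
- by rewrite /a (metric_sym x y) (metric_sym z) metric_triangle.
- by rewrite /a addrC (metric_sym x) (metric_sym y z) metric_triangle.
have ha : mdist x (g1 (a / 2)) = a / 2.
  by rewrite -{1}g1x g1i ?in_itv/= ?sub0r ?normrN ?ger0_norm//; lra.
have le_cmp : mdist (g1 (a / 2)) z <= edist2 (a / 2, 0) r.
  apply: (cmp x y z g1 g2 g3 (0, 0) (a, 0) r) => //.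
  - by rewrite /edist2 /= sub0r sqrrN subr0 expr0n /= addr0 sqrtr_sqr gtr0_norm.
  - constructor 1; split.
    + by exists (a / 2) => //=; rewrite in_itv/= -/a; lra.
    + exists (1 / 2); first by rewrite /= in_itv/=; lra.
      rewrite scaler0 add0r; congr (_, _); rewrite /GRing.scale/=; lra.
    + rewrite /edist2/= ha !sub0r oppr0 expr0n addr0 sqrrN sqrtr_sqr.
      by rewrite ger0_norm//; lra.
  (* The vertex [z] is the far endpoint of the side from [y] to [z]. *)
  - constructor 2; split => //.
    + exists (mdist y z) => //=; rewrite in_itv/= lexx andbT; exact: mdist_ge0.
    + exists 1; first by rewrite /= in_itv/= lexx ler01.
      by rewrite subrr scale0r add0r scale1r.
rewrite metric_sym -(metric_sym y).
apply: (@le_trans _ _ (edist2 (a / 2, 0) r ^+ 2)).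
  by rewrite lerXn2r ?nnegrE ?mdist_ge0 ?sqrtr_ge0.
rewrite -br -cr !edist2_sqr /=; lra.
Qed.

(** * Chebyshev centers *)

(** The Bruhat-Tits inequality at [z] in [V], with [d(z, x)] and [d(z, y)]
    bounded by the radii about [x] and [y], bounds [d(z, m)] uniformly
    in [z]. *)
Lemma radius_midpoint (R : realType) (H : metricType R) (V : set H) (x y : H) :
  cat0 H -> V !=set0 -> compact V ->
  exists m, radius_at V m ^+ 2 <=
    (radius_at V x ^+ 2 + radius_at V y ^+ 2) / 2 - mdist x y ^+ 2 / 4.
Proof.
move=> hH V0 cV; have [m hm] := cat0_midpoint x y hH; exists m.
set s := (X in _ <= X).
have sV v : V v -> mdist m v ^+ 2 <= s.
  move=> Vv; have := hm v; rewrite !(metric_sym v) => /le_trans; apply.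
  by rewrite lerD2r ler_pM2r// lerD// lerXn2r ?nnegrE ?mdist_ge0 ?radius_ge0
    ?mdist_le_radius.
have s0 : 0 <= s by have [v /sV] := V0; apply: le_trans; exact: sqr_ge0.
rewrite -(sqr_sqrtr s0) lerXn2r ?nnegrE ?radius_ge0 ?sqrtr_ge0//.
apply: radius_le => // v /sV svs.
by rewrite -(ger0_norm (mdist_ge0 m v)) -sqrtr_sqr ler_sqrt.
Qed.

(** A minimizer need not lie in a compact set known in advance, so existence
    comes from completeness: [F] is the filter of sublevel sets of the radius
    above its infimum, and uniform convexity makes it Cauchy. *)
Lemma chebyshev_center_exists (R : realType) (H : completeMetricType R)
    (V : set H) :
  cat0 H -> V !=set0 -> compact V -> exists c, chebyshev_center V c.
Proof.
move=> hH V0 cV; pose E := [set radius_at V c | c in setT].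
have lbE : has_lbound E by exists 0 => _ [c _ <-]; exact: radius_ge0.
have infE : has_inf E by split=> //; exists (radius_at V point), point.
have r0 : 0 <= inf E.
  apply: lb_le_inf; first by case: infE.
  by move=> _ [c _ <-]; exact: radius_ge0.
have leE c : inf E <= radius_at V c by apply: ge_inf => //; exists c.
pose S e : set H := [set c | radius_at V c < inf E + e].
pose F : set_system H := filter_from [set e : R | 0 < e] S.
have S0 e : 0 < e -> S e !=set0.
  by move=> e0; have [_ [c _ <-] ?] := inf_adherent e0 infE; exists c.
have FF : ProperFilter F.
  apply: filter_from_proper => //; apply: filter_from_filter.
    by exists 1 => /=.
  move=> d e d0 e0; exists (Num.min d e); first by rewrite /= lt_min d0.
  by move=> c; rewrite /S /= addr_minr lt_min => /andP[].
have FE e : 0 < e -> F (S e) by exists e.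
have cF : cauchy F.
  apply: cauchy_exP => e e0.
  (* If both radii are below [inf E + d], with [d <= 1], then
     [mdist x y ^+ 2 < 4 * ((inf E + d) ^+ 2 - inf E ^+ 2)], which is at most
     [4 * d * (2 * inf E + 1)]. *)
  pose d := Num.min 1 (e ^+ 2 / (4 * (2 * inf E + 1))).
  have E1 : 0 < 4 * (2 * inf E + 1) by lra.
  have d0 : 0 < d by rewrite lt_min ltr01 divr_gt0// exprn_gt0.
  have d1 : d <= 1 by rewrite ge_min lexx.
  have de : d * (4 * (2 * inf E + 1)) <= e ^+ 2.
    by rewrite -ler_pdivlMr// ge_min lexx orbT.
  have [x Sx] := S0 _ d0; exists x; apply: filterS (FE _ d0) => y Sy.
  rewrite ballEmdist /= -(@ltr_pXn2r _ 2) ?nnegrE ?mdist_ge0 ?ltW//.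
  have [m hm] := radius_midpoint x y hH V0 cV.
  have rsq z : S d z -> radius_at V z ^+ 2 < (inf E + d) ^+ 2.
    by move=> Sz; rewrite ltr_pXn2r ?nnegrE ?radius_ge0 ?addr_ge0// ltW.
  have := rsq _ Sx; have := rsq _ Sy.
  have : inf E ^+ 2 <= radius_at V m ^+ 2.
    by rewrite lerXn2r ?nnegrE ?radius_ge0.
  nra.
have [c Fc] := (cvg_ex _).1 (cauchy_cvg _ cF).
exists c => c'; apply: le_trans (leE c').
apply/ler_addgt0Pr => e e0; have e2 : 0 < e / 2 by lra.
have [x [xc Sx]] : ((fun x => mdist c x < e / 2) `&` S (e / 2)) !=set0.
  apply: (@filter_ex _ F); apply: filterI (FE _ e2).
  exact: (@cvgr_dist_lt _ _ _ F _ id c).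
have := radius_lipschitz c x V0 cV; move: Sx; rewrite /S /=; lra.
Qed.

(** Since [c] minimizes the radius of [V], the radius about the midpoint of [c]
    and [c'] is no smaller than the one about [c], while [c'] is a minimizer for
    [V] up to twice the Hausdorff distance; uniform convexity does the rest. *)
Lemma chebyshev_center_stable (R : realType) (H : metricType R) (V W : set H)
    (c c' : H) :
  cat0 H -> compact V -> V !=set0 -> compact W -> W !=set0 ->
  chebyshev_center V c -> chebyshev_center W c' ->
  mdist c c' ^+ 2 <=
    8 * hausdorff_dist V W * (radius_at V c + hausdorff_dist V W).
Proof.
move=> hH cV V0 cW W0 Vc Wc'; have [m hm] := radius_midpoint c c' hH V0 cV.
have : radius_at V c ^+ 2 <= radius_at V m ^+ 2.
  by rewrite lerXn2r ?nnegrE ?radius_ge0.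
have h0 := hausdorff_dist_ge0 cV V0 W0; have r0 := radius_ge0 c V0 cV.
have : radius_at V c' ^+ 2 <= (radius_at V c + 2 * hausdorff_dist V W) ^+ 2.
  rewrite lerXn2r ?nnegrE ?radius_ge0//; first lra.
  have := radius_le_hausdorff c' cV V0 cW W0.
  have := radius_le_hausdorff c cW W0 cV V0; rewrite hausdorff_distC.
  have := Wc' c; lra.
nra.
Qed.

Theorem mainTheorem3 (R : realType) (H : completeMetricType R)
    (hH : cat0 H) (B : set (set H))
    (hBK : B `<=` compact_convex_sets H) (hB : hausdorff_bounded B) :
  exists C : R, 0 < C /\
    forall V W : set H, B V -> B W ->
      mdist (cheb V) (cheb W) <= C * hausdorff_dist V W `^ (1 / 2).
Proof.
have [B0|/set0P[V0 BV0]] := eqVneq B set0.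
  by exists 1; split=> // V W; rewrite B0.
have [M hM] := hB.
have [neV0 cV0 _] := hBK _ BV0.
have hcheb V : B V -> chebyshev_center V (cheb V).
  by move=> /hBK[neV cV _]; apply: getPex; exact: chebyshev_center_exists.
have M0 : 0 <= M by apply: le_trans (hM _ _ BV0 BV0); exact: hausdorff_dist_ge0.
pose r0 := radius_at V0 point.
have r00 : 0 <= r0 by exact: radius_ge0.
(* [r0 + M] bounds the radius of every member of [B] at its center and [M]
   bounds the Hausdorff distances; the [+ 1] keeps the constant positive when
   [r0] and [M] vanish. *)
exists (Num.sqrt (8 * (r0 + 2 * M) + 1)); split.
  by rewrite sqrtr_gt0; lra.
move=> V W BV BW.
have [neV cV _] := hBK _ BV; have [neW cW _] := hBK _ BW.
have h0 := hausdorff_dist_ge0 cV neV neW.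
have rV : radius_at V (cheb V) <= r0 + M.
  apply: le_trans (hcheb _ BV point) _.
  apply: (le_trans (radius_le_hausdorff _ cV neV cV0 neV0)).
  by rewrite lerD2l hM.
rewrite mul1r powR12_sqrt// -sqrtrM; last lra.
rewrite -(ger0_norm (mdist_ge0 (cheb V) (cheb W))) -sqrtr_sqr ler_wsqrtr//.
have := chebyshev_center_stable hH cV neV cW neW (hcheb _ BV) (hcheb _ BW).
have := hM _ _ BV BW.
nra.
Qed.
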